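(* Let $\omega=(\omega_1,\omega_2)\in\mathbb{R}^2\setminus\pi\mathbb{Z}^2$ and set $$c_1=2-2\cos(\omega_1),\qquad c_2=2-2\cos(\omega_2),\qquad c_3=1+\cos(\omega_1-\omega_2)-\cos(\omega_1)-\cos(\omega_2).$$ Then a function $u:\mathbb{Z}^2\to\mathbb{R}$ satisfies, for all $(i,j)\in\mathbb{Z}^2$, the three equations $$u_{i+1,j}-2u_{i,j}+u_{i-1,j}+c_1u_{i,j}=0,$$ $$u_{i,j+1}-2u_{i,j}+u_{i,j-1}+c_2u_{i,j}=0,$$ $$u_{i+1,j}-u_{i,j}-u_{i+1,j-1}+u_{i,j-1}+u_{i-1,j}-u_{i,j}-u_{i-1,j+1}+u_{i,j+1}+2c_3u_{i,j}=0$$ if and only if there are constants $C_1,C_2\in\mathbb{R}$ such that $$u_{i,j}=C_1\cos(\omega_1 i+\omega_2 j)+C_2\sin(\omega_1 i+\omega_2 j)\quad\text{for all }(i,j)\in\mathbb{Z}^2.$$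
   Context: $\pi\mathbb{Z}^2=\{(\pi k,\pi l):k,l\in\mathbb{Z}\}$. The three equations are the finite-difference form of $\mathcal{E}\nabla u+\mathbf{c}u=0$ on $\mathbb{Z}^2$, where $\nabla$ uses forward differences, the symmetrized derivative $\mathcal{E}$ uses backward differences, and $\mathbf{c}$ is the symmetric $2\times2$ matrix with diagonal entries $c_1,c_2$ and off-diagonal entry $c_3$. *)

(* Defs.v *)
From Stdlib Require Import Reals ZArith.
Open Scope R_scope.

Definition in_piZ2 (w : R * R) : Prop :=
  exists k l : Z, w = (PI * IZR k, PI * IZR l).

(* Main.v *)
(** The first two equations turn the third into
    [u(i+1,j-1) + u(i-1,j+1) = 2 cos (w1 - w2) u(i,j)], so the system says that
    the second central differences along (1,0), (0,1) and (1,-1) act as they do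
    on a plane wave of frequency [(w1, w2)].  The off-lattice hypothesis makes
    [sin w1] or [sin w2] nonzero; by symmetry let it be [sin w1].  Subtracting
    the plane wave that agrees with [u] at (0,0) and (1,0) leaves a solution [d]
    vanishing on the row [j = 0].  Then [d(i,-1) = - d(i,1)], and the diagonal
    equation gives [d(i+1,1) = d(i-1,1)], hence [d(i+1,1) = d(i-1,1) = cos w1 d(i,1)]
    and [(1 - cos^2 w1) d(i,1) = 0]: the row [j = 1] vanishes as well, and the
    vertical recurrence propagates this to every row. *)
Require Import Defs.
From Stdlib Require Import Reals ZArith Lra Lia.
Open Scope R_scope.

Definition wave_system (a b c : R) (u : Z -> Z -> R) : Prop :=
  forall i j : Z,
    u (i + 1)%Z j + u (i - 1)%Z j = 2 * a * u i j /\
    u i (j + 1)%Z + u i (j - 1)%Z = 2 * b * u i j /\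
    u (i + 1)%Z (j - 1)%Z + u (i - 1)%Z (j + 1)%Z = 2 * c * u i j.

Definition plane_wave (w1 w2 C1 C2 : R) (i j : Z) : R :=
  C1 * cos (w1 * IZR i + w2 * IZR j) + C2 * sin (w1 * IZR i + w2 * IZR j).

(** The swap sends the direction (1,-1) to its opposite, and a central sum does not see the sign, so
    [c] is kept. *)
Lemma wave_system_swap (a b c : R) (u : Z -> Z -> R) :
  wave_system a b c u -> wave_system b a c (fun i j => u j i).
Proof.
  intros H i j. destruct (H j i) as (H1 & H2 & H3).
  repeat split; lra.
Qed.

Lemma wave_system_minus (a b c : R) (u v : Z -> Z -> R) :
  wave_system a b c u -> wave_system a b c v ->
  wave_system a b c (fun i j => u i j - v i j).
Proof.
  intros Hu Hv i j.
  destruct (Hu i j) as (U1 & U2 & U3), (Hv i j) as (V1 & V2 & V3).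
  repeat split; lra.
Qed.

Lemma cos_sin_central_sum (C1 C2 t d : R) :
  (C1 * cos (t + d) + C2 * sin (t + d)) + (C1 * cos (t - d) + C2 * sin (t - d))
  = 2 * cos d * (C1 * cos t + C2 * sin t).
Proof.
  rewrite cos_plus, sin_plus, cos_minus, sin_minus. ring.
Qed.

Lemma plane_wave_system (w1 w2 C1 C2 : R) :
  wave_system (cos w1) (cos w2) (cos (w1 - w2)) (plane_wave w1 w2 C1 C2).
Proof.
  intros i j. unfold plane_wave. rewrite !plus_IZR, !minus_IZR.
  (* The phase shifts are [w1], [w2] and [w1 - w2]; [f_equal] descends to the arguments of [cos] and
     [sin]. *)
  repeat split; rewrite <- cos_sin_central_sum; do 4 f_equal; ring.
Qed.

Lemma recurrence_zero (a : R) (f : Z -> R) :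
  (forall i : Z, f (i + 1)%Z + f (i - 1)%Z = 2 * a * f i) ->
  f 0%Z = 0 -> f 1%Z = 0 -> forall i : Z, f i = 0.
Proof.
  intros Hf H0 H1.
  (* Two consecutive zeros determine both neighbours, so the induction runs in both directions on
     pairs. *)
  assert (Hpair : forall i : Z, f i = 0 /\ f (i + 1)%Z = 0).
  { intro i. induction i as [| i [IH1 IH2] | i [IH1 IH2]] using Z.peano_ind.
    - auto.
    - unfold Z.succ. specialize (Hf (i + 1)%Z).
      replace (i + 1 - 1)%Z with i in Hf by lia.
      rewrite IH1, IH2 in Hf. split; lra.
    - unfold Z.pred. specialize (Hf i).
      replace (i + -1 + 1)%Z with i by lia.
      change (i + -1)%Z with (i - 1)%Z.
      rewrite IH1, IH2 in Hf. split; lra. }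
  intro i. apply Hpair.
Qed.

Lemma wave_system_zero (w1 b c : R) (d : Z -> Z -> R) :
  sin w1 <> 0 -> wave_system (cos w1) b c d ->
  d 0%Z 0%Z = 0 -> d 1%Z 0%Z = 0 -> forall i j : Z, d i j = 0.
Proof.
  intros Hs Hd H00 H10.
  assert (Hrow0 : forall i : Z, d i 0%Z = 0).
  { apply (recurrence_zero (cos w1)); auto. intro i. apply Hd. }
  assert (Hrow1 : forall i : Z, d i 1%Z = 0).
  { intro i.
    assert (Hodd : forall k : Z, d k (-1)%Z = - d k 1%Z).
    { intro k. destruct (Hd k 0%Z) as (_ & H & _). simpl in H.
      rewrite Hrow0 in H. lra. }
    assert (Hdiag : forall k : Z, d (k + 1)%Z 1%Z = cos w1 * d k 1%Z /\
                                  d (k - 1)%Z 1%Z = cos w1 * d k 1%Z).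
    { intro k. destruct (Hd k 0%Z) as (_ & _ & H3). simpl in H3.
      rewrite Hrow0, Hodd in H3.
      destruct (Hd k 1%Z) as (H1 & _). split; lra. }
    (* A step right from [i] and a step back left each cost a factor [cos w1], yet return to
       [d i 1]. *)
    destruct (Hdiag i) as [Hi _]. destruct (Hdiag (i + 1)%Z) as [_ Hi1].
    replace (i + 1 - 1)%Z with i in Hi1 by lia.
    rewrite Hi in Hi1.
    assert (Hp : sin w1 * (sin w1 * d i 1%Z) = 0).
    { pose proof (sin2_cos2 w1) as Hsc. unfold Rsqr in Hsc.
      replace (sin w1 * (sin w1 * d i 1%Z))
        with ((sin w1 * sin w1 + cos w1 * cos w1) * d i 1%Z
              - cos w1 * (cos w1 * d i 1%Z)) by ring.
      rewrite Hsc. lra. }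
    apply Rmult_integral in Hp as [Hp | Hp]; [contradiction |].
    apply Rmult_integral in Hp as [Hp | Hp]; [contradiction | exact Hp]. }
  intros i j. apply (recurrence_zero b (d i)); auto. intro k. apply Hd.
Qed.

Lemma wave_system_plane_wave_sin1 (w1 w2 : R) (u : Z -> Z -> R) :
  sin w1 <> 0 -> wave_system (cos w1) (cos w2) (cos (w1 - w2)) u ->
  exists C1 C2 : R, forall i j : Z, u i j = plane_wave w1 w2 C1 C2 i j.
Proof.
  intros Hs Hu.
  (* The values at (0,0) and (1,0) give [C1 = u 0 0] and [C1 * cos w1 + C2 * sin w1 = u 1 0]. *)
  exists (u 0%Z 0%Z), ((u 1%Z 0%Z - u 0%Z 0%Z * cos w1) / sin w1).
  intros i j. apply Rminus_diag_uniq. revert i j.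
  apply (wave_system_zero w1 (cos w2) (cos (w1 - w2))); auto.
  - apply wave_system_minus; auto. apply plane_wave_system.
  - unfold plane_wave. rewrite !Rmult_0_r, Rplus_0_r, cos_0, sin_0. ring.
  - unfold plane_wave. rewrite Rmult_1_r, Rmult_0_r, Rplus_0_r. now field.
Qed.

Lemma wave_system_plane_wave (w1 w2 : R) (u : Z -> Z -> R) :
  ~ in_piZ2 (w1, w2) ->
  wave_system (cos w1) (cos w2) (cos (w1 - w2)) u ->
  exists C1 C2 : R, forall i j : Z, u i j = plane_wave w1 w2 C1 C2 i j.
Proof.
  intros Hw Hu.
  destruct (Req_dec (sin w1) 0) as [Hs1 |]; [|
    now apply wave_system_plane_wave_sin1].
  destruct (Req_dec (sin w2) 0) as [Hs2 | Hs2].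
  - destruct (sin_eq_0_0 w1 Hs1) as [k Hk], (sin_eq_0_0 w2 Hs2) as [l Hl].
    exfalso. apply Hw. exists k, l. rewrite Hk, Hl. f_equal; ring.
  (* Exchanging the axes is harmless: [cos] is even and the phase is symmetric under the
     exchange. *)
  - destruct (wave_system_plane_wave_sin1 w2 w1 (fun i j => u j i))
      as (C1 & C2 & HC); auto.
    + replace (w2 - w1) with (- (w1 - w2)) by ring. rewrite cos_neg.
      now apply wave_system_swap.
    + exists C1, C2. intros i j. rewrite (HC j i). unfold plane_wave.
      now rewrite (Rplus_comm (w2 * IZR j)).
Qed.

Theorem proposition7 (w1 w2 : R) (hw : ~ in_piZ2 (w1, w2))
  (c1 c2 c3 : R)
  (hc1 : c1 = 2 - 2 * cos w1)
  (hc2 : c2 = 2 - 2 * cos w2)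
  (hc3 : c3 = 1 + cos (w1 - w2) - cos w1 - cos w2)
  (u : Z * Z -> R) :
  (forall i j : Z,
     u (i + 1, j)%Z - 2 * u (i, j) + u (i - 1, j)%Z + c1 * u (i, j) = 0 /\
     u (i, j + 1)%Z - 2 * u (i, j) + u (i, j - 1)%Z + c2 * u (i, j) = 0 /\
     u (i + 1, j)%Z - u (i, j) - u (i + 1, j - 1)%Z + u (i, j - 1)%Z
       + u (i - 1, j)%Z - u (i, j) - u (i - 1, j + 1)%Z + u (i, j + 1)%Z
       + 2 * c3 * u (i, j) = 0)
  <->
  (exists C1 C2 : R, forall i j : Z,
     u (i, j) = C1 * cos (w1 * IZR i + w2 * IZR j)
              + C2 * sin (w1 * IZR i + w2 * IZR j)).
Proof.
  subst c1 c2 c3. split.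
  - intro H.
    apply (wave_system_plane_wave w1 w2 (fun i j => u (i, j)) hw).
    (* In the diagonal equation, [2 * c3 - 2 + 2 * cos w1 + 2 * cos w2] collapses to
       [2 * cos (w1 - w2)]. *)
    intros i j. destruct (H i j) as (H1 & H2 & H3). repeat split; lra.
  - intros (C1 & C2 & HC) i j.
    change (forall i j : Z, u (i, j) = plane_wave w1 w2 C1 C2 i j) in HC.
    rewrite !HC.
    destruct (plane_wave_system w1 w2 C1 C2 i j) as (H1 & H2 & H3).
    repeat split; lra.
Qed.
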